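(* Let $b\ge 2$ be an integer, let $D\subset\{0,1,\dots,b-1\}$ be a nonempty proper subset, let $S\subset\mathbb{N}$ be an infinite set, and let $$E_{S,D}=\Big\{\sum_{n=1}^\infty x_n b^{-n} : x_n\in D \text{ if } n\notin S, \text{ and } x_n\in\{0,1,\dots,b-1\} \text{ if } n\in S\Big\}\subset[0,1].$$ Suppose that $\mathbb{N}\setminus S$ is not finite. Then the Fourier dimension of $E_{S,D}$ satisfies $\dim_F E_{S,D}=0$.
   Context: $\mathbb{N}=\{1,2,3,\dots\}$. Fourier dimension: for $A\subset\mathbb{R}$, $$\dim_F A=\sup\Big\{\beta\in[0,1] : \text{there exist a (Borel) probability measure } \mu \text{ on } A \text{ and a constant } C>0 \text{ such that } |\widehat{\mu}(\xi)|\le C|\xi|^{-\beta/2} \text{ for all } \xi\in\mathbb{R}\setminus\{0\}\Big\},$$ where $\widehat{\mu}(\xi)=\int e^{-2\pi i\xi x}\,d\mu(x)$ is the Fourier transform of $\mu$. *)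

(* Defs.v *)
From HB Require Import structures.
From mathcomp Require Import all_boot all_order all_algebra.
From mathcomp Require Import all_classical all_reals all_analysis.
From mathcomp Require Export complex.

Set Implicit Arguments.
Unset Strict Implicit.
Unset Printing Implicit Defensive.

Import Order.TTheory GRing.Theory Num.Theory.
Import numFieldNormedType.Exports.

Local Open Scope classical_set_scope.
Local Open Scope ring_scope.
Local Open Scope complex_scope.

Definition expi {R : realType} (t : R) : R[i] := cos t +i* sin t.

Definition Cintegral {d : measure_display} {T : measurableType d}
    {R : realType} (mu : {measure set T -> \bar R}) (f : T -> R[i]) : R[i] :=
  (\int[mu]_x complex.Re (f x)) +i* (\int[mu]_x complex.Im (f x)).

Definition fourier_transform {R : realType}
    (mu : probability (measurableTypeR R) R) (xi : R) : R[i] :=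
  Cintegral mu (fun x : R => expi (- (2 * pi * xi * x))).

(* [mu] is a Borel probability measure on the line; for Borel [A],
   negligibility of the complement of [A] says [mu A = 1]. *)
Definition fourier_decay {R : realType} (A : set R) (beta : R) : Prop :=
  exists mu : probability (measurableTypeR R) R, mu.-negligible (~` A) /\
    exists2 C : R, 0 < C & forall xi : R, xi != 0 ->
      `|fourier_transform mu xi| <= (C * `|xi| `^ (- beta / 2))%:C.

(* [sup] takes the value 0 on the empty set, so [fourier_dim set0 = 0]. *)
Definition fourier_dim {R : realType} (A : set R) : R :=
  sup [set beta : R | 0 <= beta <= 1 /\ fourier_decay A beta].

(* Digit sequences are indexed from 1; the value at index 0 plays no role. *)
Definition digit_set (R : realType) (b : nat) (S D : set nat) : set R :=
  [set \big[+%R/0]_(1 <= n <oo) ((x n)%:R * b%:R ^- n : R) | x in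
    [set x : nat -> nat | forall n : nat, (0 < n)%N ->
      (~ S n -> D (x n)) /\ (S n -> `I_b (x n))]].

(* Main.v *)
Require Import Defs.
From HB Require Import structures.
From mathcomp Require Import all_boot all_order all_algebra.
From mathcomp Require Import all_classical all_reals all_analysis.
From mathcomp Require Import measurable_realfun ring lra.

(** Every probability measure carried by the set has Fourier coefficients
    that do not tend to zero, so no positive decay exponent is possible.

    Let [mu] be carried by the set, fix a digit [d0] outside [D], and let [n]
    be one of the infinitely many positions outside [S].  Write [q = b^(n-1)].
    For [x] in the set, [q x] is an integer plus a base-[b] expansion whose
    first digit lies in [D], so [q x] modulo 1 stays at distance at least [1/(2b)]
    from the midpoint [c] of the forbidden interval [[d0/b, (d0+1)/b]]
    ([digit_set_gap]).  The geometric sum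
      [Z(x) = sum_(j < N) exp(2 i pi j (q x - c))]
    then satisfies [|Z(x)|^2 <= 1 / sin(pi/(2b))^2], a bound that involves
    neither [N] nor [n] ([expsum_sqr_le], [expsum_mean_le]).

    On the other hand, expanding the square,
      [|Z(x)|^2 = sum_(j, l < N) cos(2 pi (j - l) (q x - c))],
    where the diagonal contributes [N] and each off-diagonal term integrates
    to something controlled by the Fourier transform of [mu] at
    [(j - l) q].  Under a decay of positive exponent these are negligible for
    large [q], so the mean of [|Z|^2] is almost [N] ([expsum_mean_ge]).
    Choosing first [N] beyond the uniform bound, then [n] large, gives a
    contradiction ([fourier_decay_le0]).  All admissible exponents are
    therefore [0], and so is their supremum. *)

Set Implicit Arguments.
Unset Strict Implicit.
Unset Printing Implicit Defensive.

Import Order.TTheory GRing.Theory Num.Theory.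
Import numFieldNormedType.Exports.

Local Open Scope classical_set_scope.
Local Open Scope ring_scope.

(** * Squared modulus of a geometric sum of exponentials *)

(** This is [|sum_(j < N) exp(2 i j t)|^2], kept in real form because
    integrals of complex functions are taken componentwise. *)
Definition expsum_sqr {R : realType} (N : nat) (t : R) : R :=
  (\sum_(j < N) cos (j%:R * (t *+ 2))) ^+ 2
  + (\sum_(j < N) sin (j%:R * (t *+ 2))) ^+ 2.

(** Multiplying by [2 sin t] turns the sum into a telescoping one; likewise
    for sines below. *)
Lemma sin_sum_cos {R : realType} (N : nat) (t : R) :
  2 * sin t * (\sum_(j < N) cos (j%:R * (t *+ 2)))
  = sin (N%:R * (t *+ 2) - t) + sin t.
Proof.
elim: N => [|N IH]; first by rewrite big_ord0 mul0r sub0r sinN; ring.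
rewrite big_ord_recr /= mulrDr IH.
have -> : N.+1%:R * (t *+ 2) - t = N%:R * (t *+ 2) + t by rewrite -natr1; ring.
by rewrite sinB sinD; ring.
Qed.

Lemma sin_sum_sin {R : realType} (N : nat) (t : R) :
  2 * sin t * (\sum_(j < N) sin (j%:R * (t *+ 2)))
  = cos t - cos (N%:R * (t *+ 2) - t).
Proof.
elim: N => [|N IH]; first by rewrite big_ord0 mul0r sub0r cosN; ring.
rewrite big_ord_recr /= mulrDr IH.
have -> : N.+1%:R * (t *+ 2) - t = N%:R * (t *+ 2) + t by rewrite -natr1; ring.
by rewrite cosB cosD; ring.
Qed.

(** The closed form is [sin(N t)^2 / sin(t)^2]; multiplying out keeps the
    bound meaningful when [sin t = 0]. *)
Lemma expsum_sqr_le {R : realType} (N : nat) (t : R) :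
  sin t ^+ 2 * expsum_sqr N t <= 1.
Proof.
have Hc := sin_sum_cos N t; have Hs := sin_sum_sin N t.
rewrite /expsum_sqr; move: Hc Hs.
set X := \sum_(j < N) _; set Y := \sum_(j < N) _; set A := _ - t => Hc Hs.
have := cos_geN1 (A + t); rewrite cosD => HA.
have E : 4 * (sin t ^+ 2 * (X ^+ 2 + Y ^+ 2))
   = (sin A + sin t) ^+ 2 + (cos t - cos A) ^+ 2 by rewrite -Hc -Hs; ring.
have := cos2Dsin2 t; have := cos2Dsin2 A => E1 E2.
nra.
Qed.

(** The diagonal terms of this expansion are all [1]; the others oscillate. *)
Lemma expsum_sqrE {R : realType} (N : nat) (t : R) :
  expsum_sqr N t
  = \sum_(j < N) \sum_(l < N) cos ((j%:R - l%:R) * (t *+ 2)).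
Proof.
rewrite /expsum_sqr !expr2 !big_distrlr /= -big_split /=.
apply: eq_bigr => j _; rewrite -big_split /=; apply: eq_bigr => l _.
by rewrite mulrBl cosB.
Qed.

(** * Points away from the integers *)

(** By the symmetry of the sine about [pi / 2] only [v <= 1 / 2] matters, where
    the sine increases. *)
Lemma ler_sin_pi {R : realType} (a v : R) :
  0 <= a -> a <= v <= 1 - a -> sin (pi * a) <= sin (pi * v).
Proof.
have pi0 : 0 < pi :> R := pi_gt0 R.
have small w : 0 <= a -> a <= w <= 1 / 2 -> sin (pi * a) <= sin (pi * w).
  move=> a0 /andP[aw w2]; rewrite leNgt ltr_sin ?in_itv /=.
  - by rewrite -leNgt ler_pM2l.
  - by apply/andP; split; nra.
  - by apply/andP; split; nra.
move=> a0 /andP[av va]; have [v2|v2] := leP v (1 / 2).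
  by apply: small; rewrite ?av.
have -> : sin (pi * v) = sin (pi * (1 - v)).
  have -> : pi * (1 - v) = - (pi * v) + pi by ring.
  by rewrite sinDpi sinN opprK.
by apply: small => //; apply/andP; split; lra.
Qed.

Lemma sin_sqr_natpi {R : realType} (m : nat) (v : R) :
  sin (pi * (m%:R + v)) ^+ 2 = sin (pi * v) ^+ 2.
Proof.
elim: m => [|m IH]; first by rewrite add0r.
have -> : pi * (m.+1%:R + v) = pi * (m%:R + v) + pi by rewrite -natr1; ring.
by rewrite sinDpi sqrrN.
Qed.

Lemma sin_sqr_away {R : realType} (a v : R) :
  0 <= a <= 1 / 2 -> a <= `|v| <= 1 - a -> sin (pi * a) ^+ 2 <= sin (pi * v) ^+ 2.
Proof.
move=> /andP[a0 a2] /(ler_sin_pi a0) h.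
have pi0 : 0 < pi :> R := pi_gt0 R.
have s0 : 0 <= sin (pi * a) by apply: sin_ge0_pi; apply/andP; split; nra.
have -> : sin (pi * v) ^+ 2 = sin (pi * `|v|) ^+ 2.
  by case: (ger0P v) => // _; rewrite mulrN sinN sqrrN.
by rewrite ler_sqr ?nnegrE // (le_trans s0).
Qed.

(** * Shifting the digit expansion *)

Definition digit_partial_sum (R : realType) (b : nat) (x : nat -> nat)
    (k : nat) : R := \sum_(1 <= n < k) (x n)%:R * b%:R ^- n.

Lemma digit_partial_sumS {R : realType} (b : nat) (x : nat -> nat) (k : nat) :
  digit_partial_sum R b x k.+2
  = digit_partial_sum R b x k.+1 + (x k.+1)%:R * b%:R ^- k.+1.
Proof. by rewrite /digit_partial_sum big_nat_recr. Qed.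

Lemma digit_partial_sum_nat {R : realType} (b : nat) (x : nat -> nat) (p : nat) :
  (0 < b)%N -> exists m : nat, b%:R ^+ p * digit_partial_sum R b x p.+1 = m%:R.
Proof.
move=> b0; elim: p => [|p [m IH]].
  by exists 0%N; rewrite /digit_partial_sum big_geq // mulr0.
exists (b * m + x p.+1)%N.
rewrite digit_partial_sumS natrD natrM -IH mulrDr exprS mulrCA mulfV.
  by ring.
by rewrite -exprS expf_neq0 // pnatr_eq0 -lt0n.
Qed.

Lemma digit_partial_sum_nondecreasing {R : realType} (b : nat)
    (x : nat -> nat) : nondecreasing_seq (digit_partial_sum R b x).
Proof.
apply/nondecreasing_seqP => -[|k]; first by rewrite /digit_partial_sum !big_geq.
by rewrite digit_partial_sumS lerDl mulr_ge0 // invr_ge0 exprn_ge0.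
Qed.

(** Adding [b^-k] accounts for a tail made only of digits [b - 1], which
    makes the sequence nonincreasing; hence it bounds the whole expansion. *)
Lemma digit_partial_sum_tail {R : realType} (b : nat) (x : nat -> nat)
    (k i : nat) : (0 < b)%N -> (forall n, (0 < n)%N -> (x n < b)%N) ->
  digit_partial_sum R b x (k + i).+1 + b%:R ^- (k + i)
  <= digit_partial_sum R b x k.+1 + b%:R ^- k.
Proof.
move=> b0 xb; have bR0 : 0 < b%:R :> R by rewrite ltr0n.
elim: i => [|i IH]; first by rewrite addn0.
rewrite addnS digit_partial_sumS; apply: le_trans IH; rewrite -addrA lerD2l.
have -> : b%:R ^- (k + i) = b%:R * b%:R ^- (k + i).+1 :> R.
  by rewrite exprS invfM mulrA mulfV ?mul1r // gt_eqF.
rewrite -[X in _ + X]mul1r -mulrDl ler_pM2r ?invr_gt0 ?exprn_gt0 //.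
by rewrite natr1 ler_nat xb.
Qed.

(** Multiplication by [b^p] moves the first [p] digits into the integer part
    [m], so that digit [p + 1] locates the rest to within [1 / b].  The bounds
    are closed because an expansion may end in digits that are all [b - 1]. *)
Lemma digit_shift {R : realType} (b : nat) (x : nat -> nat) (p : nat) :
  (0 < b)%N -> (forall n, (0 < n)%N -> (x n < b)%N) -> exists m : nat,
  m%:R + (x p.+1)%:R / b%:R
   <= b%:R ^+ p * \big[+%R/0]_(1 <= n <oo) ((x n)%:R * b%:R ^- n : R)
   <= m%:R + ((x p.+1)%:R + 1) / b%:R.
Proof.
move=> b0 xb; have bR0 : 0 < b%:R :> R by rewrite ltr0n.
have [m Em] := digit_partial_sum_nat (R := R) x p b0; exists m.
pose P := digit_partial_sum R b x.
have ndP : nondecreasing_seq P := @digit_partial_sum_nondecreasing R b x.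
have le_tail k i : P (k + i).+1 <= P k.+1 + b%:R ^- k.
  apply: le_trans (digit_partial_sum_tail k i b0 xb).
  by rewrite lerDl invr_ge0 exprn_ge0.
have cvP : cvgn P.
  apply: nondecreasing_is_cvgn => //; exists 1 => _ [k _ <-].
  apply: (le_trans (ndP k k.+1 (leqnSn k))); apply: le_trans (le_tail 0 k) _.
  by rewrite expr0 invr1 /P /digit_partial_sum big_geq // add0r.
have lo : P p.+2 <= limn P.
  by apply: limr_ge => //; exists p.+2 => //= k pk; exact: ndP.
have hi : limn P <= P p.+2 + b%:R ^- p.+1.
  apply: limr_le => //; exists p.+2 => //= k pk.
  apply: (le_trans (ndP k k.+1 (leqnSn k))).
  by have := le_tail p.+1 (k - p.+1)%N; rewrite subnKC // ltnW.
have Eb (z : R) : b%:R ^+ p * (P p.+1 + z * b%:R ^- p.+1) = m%:R + z / b%:R.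
  rewrite mulrDr Em exprS invfM; congr (_ + _).
  by rewrite mulrCA [_^-1 * _]mulrC mulVKf // expf_neq0 // gt_eqF.
have bp : 0 < b%:R ^+ p :> R by rewrite exprn_gt0.
have PS : P p.+2 = P p.+1 + (x p.+1)%:R * b%:R ^- p.+1.
  exact: digit_partial_sumS.
rewrite -!Eb !ler_pM2l //; apply/andP; split; first by rewrite -PS.
by rewrite mulrDl mul1r addrA -PS.
Qed.

(** If the digit at position [p + 1] is constrained, it differs from [d0], so
    modulo 1 the point [b^p y] lies in the closed cell of another digit, at
    distance at least [1 / (2 b)] from the centre of the cell of [d0]. *)
Lemma digit_set_gap {R : realType} (b : nat) (S D : set nat) (d0 p : nat) (y : R) :
  (d0 < b)%N -> ~ D d0 -> D `<=` `I_b -> ~ S p.+1 -> digit_set b S D y ->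
  sin (pi * (1 / (2 * b%:R))) ^+ 2
  <= sin (pi * (b%:R ^+ p * y - (d0%:R + 1 / 2) / b%:R)) ^+ 2.
Proof.
move=> d0b Dd0 DIb Sp [x xSD <-].
have b0 : (0 < b)%N by apply: leq_ltn_trans d0b.
have xb n : (0 < n)%N -> (x n < b)%N.
  move=> /xSD [nSD SD]; have [/SD//|/nSD /DIb//] := pselect (S n).
have Dx : D (x p.+1) by apply: (xSD p.+1 isT).1.
have xd0 : x p.+1 != d0 by apply: contra_notN Dd0 => /eqP <-.
have [m] := digit_shift (R := R) p b0 xb.
set z := b%:R ^+ p * _; move: (x p.+1) (xb p.+1 isT) xd0 => d db dd0.
have bR : 0 < b%:R :> R by rewrite ltr0n.
move=> /andP[lo hi].
set c := (_ + _) / _.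
have -> : z - c = m%:R + (z - m%:R - c) by ring.
rewrite sin_sqr_natpi.
set v := z - m%:R - c.
have Ev : v * b%:R = (z - m%:R) * b%:R - (d0%:R + 1 / 2).
  by rewrite /v /c mulrBl divfK // gt_eqF.
have lo' : d%:R <= (z - m%:R) * b%:R by rewrite -ler_pdivrMr // lerBrDl.
have hi' : (z - m%:R) * b%:R <= d%:R + 1 by rewrite -ler_pdivlMr // lerBlDl.
have b2 : 2 <= b%:R :> R.
  rewrite (ler_nat R 2 b); move: dd0 db d0b; rewrite neq_ltn.
  by case/orP=> h1 h2 h3; [apply: leq_ltn_trans h3|apply: leq_ltn_trans h2]; apply: leq_ltn_trans h1.
have dB : d%:R + 1 <= b%:R :> R by rewrite natr1 ler_nat.
have d0B : d0%:R + 1 <= b%:R :> R by rewrite natr1 ler_nat.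
have ge0 : 0 <= d%:R :> R by [].
have ge00 : 0 <= d0%:R :> R by [].
have av : 1 / 2 <= `|v| * b%:R <= b%:R - 1 / 2.
  have -> : `|v| * b%:R = `|v * b%:R| by rewrite normrM (gtr0_norm bR).
  rewrite Ev.
  move: dd0; rewrite neq_ltn => /orP[] lt.
    have dd : d%:R + 1 <= d0%:R :> R by rewrite natr1 ler_nat.
    by rewrite ler0_norm; last lra; apply/andP; split; lra.
  have dd : d0%:R + 1 <= d%:R :> R by rewrite natr1 ler_nat.
  by rewrite ger0_norm; last lra; apply/andP; split; lra.
have -> : 1 / (2 * b%:R) = (1 / 2) / b%:R :> R by rewrite !mul1r invfM.
apply: sin_sqr_away.
  by rewrite divr_ge0 ?ler_pdivrMr ?ltW //=; lra.
case/andP: av => av1 av2; apply/andP; split; first by rewrite ler_pdivrMr.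
by rewrite -(ler_pM2r bR) mulrBl divfK ?gt_eqF //; lra.
Qed.

(** * Two estimates for the mean of the squared sum *)

Lemma integrable_trig {R : realType} (mu : probability (measurableTypeR R) R)
    (f : R -> R) (k a : R) :
  continuous f -> (forall t, `|f t| <= 1) ->
  mu.-integrable setT (EFin \o (fun x : measurableTypeR R => f (k * x - a))).
Proof.
move=> cf f1; apply: measurable_bounded_integrable => //.
- by move: (ltry (1:R)); rewrite -(probability_setT mu).
- apply: continuous_measurable_fun => x.
  apply: continuous_comp; last exact: cf.
  by apply: cvgB; [apply: cvgM; [exact: cvg_cst|exact: cvg_id]|exact: cvg_cst].
- exists 1; split => // M M1 x _ /=; exact: le_trans (f1 _) (ltW M1).
Qed.

Lemma integrable_cos {R : realType} (mu : probability (measurableTypeR R) R)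
    (k a : R) :
  mu.-integrable setT (EFin \o (fun x : measurableTypeR R => cos (k * x - a))).
Proof. by apply: integrable_trig; [exact: continuous_cos|exact: cos_max]. Qed.

Lemma integrable_sin {R : realType} (mu : probability (measurableTypeR R) R)
    (k a : R) :
  mu.-integrable setT (EFin \o (fun x : measurableTypeR R => sin (k * x - a))).
Proof. by apply: integrable_trig; [exact: continuous_sin|exact: sin_max]. Qed.

(** By the addition formula the integral combines the real and imaginary
    parts of the transform with coefficients of modulus at most 1, whence the
    factor 2. *)
Lemma fourier_transform_cos_ge {R : realType} (mu : probability (measurableTypeR R) R)
    (xi a r : R) :
  `|fourier_transform mu xi| <= r%:C%C ->
  - (2 * r) <= \int[mu]_x cos (2 * pi * xi * x - a).
Proof.
rewrite /fourier_transform /Cintegral /=.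
set I1 := Rintegral _ _ _; set I2 := Rintegral _ _ _.
move=> h.
have nI : Num.sqrt (I1 ^+ 2 + I2 ^+ 2) <= r.
  by move: h; rewrite normc_def /= lecR.
have h1 : `|I1| <= r.
  by apply: le_trans nI; rewrite -sqrtr_sqr ler_wsqrtr // lerDl sqr_ge0.
have h2 : `|I2| <= r.
  by apply: le_trans nI; rewrite -sqrtr_sqr ler_wsqrtr // lerDr sqr_ge0.
have -> : \int[mu]_x cos (2 * pi * xi * x - a) = cos a * I1 - sin a * I2.
  have ic := integrable_cos mu (- (2 * pi * xi)) 0.
  have isn := integrable_sin mu (- (2 * pi * xi)) 0.
  transitivity (\int[mu]_x (cos a * cos (- (2 * pi * xi) * x - 0)
                           - sin a * sin (- (2 * pi * xi) * x - 0))).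
    apply: eq_Rintegral => x _.
    by rewrite subr0 mulNr cosN sinN cosB; ring.
  rewrite RintegralB //.
  - rewrite !RintegralZl //; congr (_ * _ - _ * _); apply: eq_Rintegral => x _;
    by rewrite subr0 mulNr.
  - exact: (integrableZl _ (cos a) ic).
  - exact: (integrableZl _ (sin a) isn).
have := cos_max a; have := sin_max a => sa ca.
have : `|cos a * I1| <= r by rewrite normrM -[leRHS]mul1r ler_pM.
have : `|sin a * I2| <= r by rewrite normrM -[leRHS]mul1r ler_pM.
by rewrite !ler_norml => /andP[_ ?] /andP[? _]; lra.
Qed.

(** The hypothesis is applied with [m = j - l] for [j != l]; the [N] diagonal
    terms contribute 1 each, and the loss on the others is at most [N^2 e]. *)
Lemma expsum_mean_ge {R : realType} (mu : probability (measurableTypeR R) R)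
    (N : nat) (k c e : R) :
  0 <= e ->
  (forall m a : R, 1 <= `|m| -> - e <= \int[mu]_x cos (m * k * x - a)) ->
  ((N%:R - N%:R ^+ 2 * e)%:E
   <= \int[mu]_x (expsum_sqr N ((k * x - c) / 2))%:E)%E.
Proof.
move=> e0 he.
have E (x : R) : expsum_sqr N ((k * x - c) / 2) =
  \sum_(j < N) \sum_(l < N)
    cos ((j%:R - l%:R) * k * x - (j%:R - l%:R) * c).
  rewrite expsum_sqrE; apply: eq_bigr => j _; apply: eq_bigr => l _.
  by congr cos; rewrite -mulr_natr; field.
have ic (j l : 'I_N) := integrable_cos mu ((j%:R - l%:R) * k) ((j%:R - l%:R) * c).
under eq_integral do (rewrite E -sumEFin; under eq_bigr do rewrite -sumEFin).
rewrite integral_sum //; last by move=> j; apply: integrable_sum => // l _; exact: ic.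
rewrite [leRHS](_ : _ = (\sum_(j < N) \sum_(l < N)
   \int[mu]_x cos ((j%:R - l%:R) * k * x - (j%:R - l%:R) * c))%:E); last first.
  rewrite -sumEFin; apply: eq_bigr => j _.
  rewrite integral_sum //; last by move=> l; exact: ic.
  rewrite -sumEFin; apply: eq_bigr => l _.
  by rewrite /Rintegral fineK //; apply: integrable_fin_num => //; exact: ic.
rewrite lee_fin.
(* The loss [e] is charged to the diagonal too, to keep the sum uniform. *)
have -> : N%:R - N%:R ^+ 2 * e = \sum_(j < N) \sum_(l < N) ((j == l)%:R - e).
  transitivity (\sum_(j < N) (1 - N%:R * e)).
    by rewrite sumr_const card_ord -mulr_natl; ring.
  apply: eq_bigr => j _; rewrite big_split /= sumr_const card_ord mulNrn -[e *+ N]mulr_natl.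
  by rewrite (bigD1 j) //= eqxx big1 ?addr0 // => l /negbTE; rewrite eq_sym => ->.
apply: ler_sum => j _; apply: ler_sum => l _.
have [->|jl] := eqVneq j l.
  under eq_Rintegral do rewrite subrr !mul0r subr0 cos0.
  have mu1 : fine (mu setT) = 1 := congr1 fine (probability_setT mu).
  by rewrite Rintegral_cst // [fine _]mu1 mulr1 gerBl.
rewrite sub0r; apply: he.
move: jl; rewrite -val_eqE neq_ltn => /orP[] lt.
  have dd : j%:R + 1 <= l%:R :> R by rewrite natr1 ler_nat.
  by rewrite ler0_norm; lra.
have dd : l%:R + 1 <= j%:R :> R by rewrite natr1 ler_nat.
by rewrite ger0_norm; lra.
Qed.

(** The bound on the integrand fails only off [A], a negligible set. *)
Lemma expsum_mean_le {R : realType} (mu : probability (measurableTypeR R) R)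
    (A : set R) (N : nat) (k c s : R) :
  0 < s -> mu.-negligible (~` A) ->
  (forall x, A x -> s <= sin ((k * x - c) / 2) ^+ 2) ->
  (\int[mu]_x (expsum_sqr N ((k * x - c) / 2))%:E <= (s^-1)%:E)%E.
Proof.
move=> s0 muA hA.
rewrite [leRHS](_ : _ = \int[mu]_x (s^-1)%:E)%E; last first.
  rewrite integral_cst // -[LHS]mule1; congr (_ * _)%E.
  exact/esym/(probability_setT mu).
have eq0 t : 0 <= expsum_sqr N t :> R by rewrite addr_ge0 // sqr_ge0.
have cg : continuous (fun x : R => (k * x - c) / 2).
  move=> x; apply: cvgM; last exact: cvg_cst.
  by apply: cvgB; [apply: cvgM; [exact: cvg_cst|exact: cvg_id]|exact: cvg_cst].
apply: ae_ge0_le_integral => //.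
- by move=> x _; rewrite lee_fin.
- apply/measurable_EFinP; apply: measurable_funD;
    apply: measurable_funX;
    apply: measurable_sum => j;
    apply: continuous_measurable_fun => x.
  + apply: continuous_comp; last exact: continuous_cos.
    by apply: cvgM; [exact: cvg_cst|apply: cvgMn; exact: cg].
  + apply: continuous_comp; last exact: continuous_sin.
    by apply: cvgM; [exact: cvg_cst|apply: cvgMn; exact: cg].
- by move=> x _; rewrite lee_fin invr_ge0 ltW.
- apply: negligibleS muA => x /= h Ax; apply: h => _.
  have h := expsum_sqr_le N ((k * x - c) / 2).
  rewrite lee_fin -(ler_pM2l s0) mulfV ?gt_eqF //; apply: le_trans h.
  by rewrite ler_wpM2r // hA.
Qed.

(** * Vanishing of the dimension *)

Lemma infinite_set_ge (A : set nat) (n : nat) :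
  infinite_set A -> exists2 m, A m & (n <= m)%N.
Proof.
move=> infA; apply: contrapT => h; apply: infA.
apply: (sub_finite_set _ (finite_II n)) => m Am /=.
by rewrite ltnNge; apply/negP => nm; apply: h; exists m.
Qed.

(** Positive decay would make every coefficient at a nonzero multiple of [b^p]
    small for large [p], which the two estimates of the mean forbid. *)
Lemma fourier_decay_le0 {R : realType} (b : nat) (D S : set nat) (beta : R) :
  (1 < b)%N -> D `<` `I_b -> infinite_set ([set n | (0 < n)%N] `\` S) ->
  fourier_decay (digit_set b S D) beta -> beta <= 0.
Proof.
move=> b1 [DIb nIbD] infS [mu [muE [C C0 hC]]].
rewrite leNgt; apply/negP => beta0.
have [d0 [d0b Dd0]] : exists d0, (d0 < b)%N /\ ~ D d0.
  by apply: contrapT => h; apply: nIbD => d db; apply: contrapT => Dd; apply: h; exists d.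
have bR : 1 <= b%:R :> R by rewrite ler1n (leq_ltn_trans _ d0b).
have pi0 : 0 < pi :> R := pi_gt0 R.
pose s : R := sin (pi * (1 / (2 * b%:R))) ^+ 2.
have s0 : 0 < s.
  rewrite exprn_gt0 // sin_gt0_pi //; apply/andP; split.
    by rewrite mulr_gt0 // divr_gt0 //; lra.
  by rewrite -[ltRHS]mulr1 ltr_pM2l // ltr_pdivrMr; lra.
(* [N] exceeds the uniform bound [s^-1] by more than 1, while the total
   off-diagonal loss [N^2 e] is exactly 1. *)
pose N := (Num.truncn (s^-1)).+2.
have NR : s^-1 + 1 < N%:R.
  by rewrite -natr1 ltrD2r truncnS_gt.
have N0 : 0 < N%:R :> R by rewrite ltr0n.
pose e : R := (N%:R ^+ 2)^-1.
have e0 : 0 < e by rewrite invr_gt0 exprn_gt0.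
(* Decay makes the transform at most [e / 2] at [xi] as soon as
   [|xi|^(beta / 2) >= L]. *)
pose L : R := 2 * C / e.
have L0 : 0 <= L by rewrite divr_ge0 ?mulr_ge0 // ltW.
have [[//|p] [_ /= Sp] pn] := infinite_set_ge (Num.truncn (L `^ (2 / beta))).+2 infS.
have pL : L `^ (2 / beta) <= b%:R ^+ p.
  apply: (le_trans (ltW (truncnS_gt _))).
  by rewrite -natrX ler_nat (leq_trans _ (ltnW (ltn_expl p b1))).
pose c : R := (d0%:R + 1 / 2) / b%:R.
have ang (x : R) : (2 * pi * b%:R ^+ p * x - 2 * pi * c) / 2 = pi * (b%:R ^+ p * x - c).
  by field.
have up := @expsum_mean_le R mu _ N (2 * pi * b%:R ^+ p) (2 * pi * c) s s0 muE.
have lo := @expsum_mean_ge R mu N (2 * pi * b%:R ^+ p) (2 * pi * c) e (ltW e0).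
have : ((N%:R - N%:R ^+ 2 * e)%:E <= (s^-1)%:E)%E.
  apply: le_trans (lo _) (up _).
    move=> m a m1.
    have -> : - e = - (2 * (e / 2)) by field.
    have bp : 0 < b%:R ^+ p :> R by rewrite exprn_gt0 //; lra.
    rewrite [X in Rintegral mu _ X](_ : _ = fun x => cos (2 * pi * (m * b%:R ^+ p) * x - a)); last first.
      by apply/funext => x; congr cos; ring.
    apply: fourier_transform_cos_ge.
    have m0 : m != 0 by rewrite -normr_gt0 (lt_le_trans _ m1).
    apply: le_trans (hC _ _) _; first by rewrite mulf_neq0 // gt_eqF.
    rewrite lecR mulNr powRN ler_pdivrMr; last first.
      by rewrite powR_gt0 // normr_gt0 mulf_neq0 // gt_eqF.
    have : L <= `|m * b%:R ^+ p| `^ (beta / 2).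
      have -> : L = (L `^ (2 / beta)) `^ (beta / 2).
        rewrite -powRrM (_ : _ * _ = 1) ?powRr1 //; by field; rewrite gt_eqF.
      apply: ge0_ler_powR; rewrite ?nnegrE ?powR_ge0 ?normr_ge0 //.
        by rewrite divr_ge0 // ltW.
      by apply: le_trans pL _; rewrite normrM (gtr0_norm bp) ler_peMl // ltW.
    rewrite /L ler_pdivrMr //; lra.
  move=> x Ax; rewrite ang; exact: digit_set_gap Ax.
rewrite lee_fin /e mulfV; first by lra.
by rewrite expf_neq0 // gt_eqF.
Qed.

Theorem theorem2p2 (R : realType) (b : nat) (hb : (2 <= b)%N)
    (D : set nat) (hD0 : D !=set0) (hD : D `<` `I_b)
    (S : set nat) (hSN : S `<=` [set n | (0 < n)%N]) (hS : infinite_set S)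
    (hSc : ~ finite_set ([set n | (0 < n)%N] `\` S)) :
  fourier_dim (@digit_set R b S D) = 0.
Proof.
rewrite /fourier_dim; set B := [set beta | _].
(* The set of exponents is empty or reduced to [0], and [sup set0 = 0]. *)
have [->|/set0P [beta Bbeta]] := eqVneq B set0; first exact: sup0.
suff -> : B = [set 0] by rewrite sup1.
have B0 (r : R) : B r -> r = 0.
  case=> /andP[r0 _] /(fourier_decay_le0 hb hD hSc) r0'.
  by apply/eqP; rewrite eq_le r0 r0'.
apply/seteqP; split => [r /B0 //|r ->].
by rewrite -(B0 _ Bbeta).
Qed.
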